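(* Let $\Delta\ge2$ be an integer and $\Lambda$ a real constant. Let $G=(V,E,w)$ be a weighted tree with $|V|=n\ge2$, weights $w:E\to\mathbb{R}_{>0}$, and maximum degree at most $\Delta$. Suppose that for every $S\subseteq V$ with $G[S]$ connected and $|S|\ge2$ there is an edge $e_S\in E(G[S])$ whose removal from the tree $G[S]$ produces components $A$ and $B$ (vertex sets) satisfying $$\max\{|A|-1,|B|-1\}\le\left(1-\frac1\Delta\right)(|S|-1)$$ and which also satisfies $$w_{e_S}\le\Lambda\,\frac{W(S)}{|S|-1}.$$ Then $$\frac{\operatorname{OPT}_{\mathrm{card}}(G,w)}{\operatorname{OPT}_{\mathrm{free}}(G,w)}\le\Lambda\left(1+\left\lfloor\log_{\Delta/(\Delta-1)}(n-1)\right\rfloor\right).$$ In particular, for a weighted tree $G$ of maximum degree at most $\Delta$, this bound holds if $$\frac{\max_{e\in E}w_e}{\min_{e\in E}w_e}\le\Lambda.$$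
   Context: $W(S)=\sum_{xy\in E(G[S])}w_{xy}$. $d_G$ is the shortest-path metric of $(V,E)$ with every edge of length $1$ (weights are not lengths). $\operatorname{OPT}_{\mathrm{free}}(G,w)$ is the minimum of $\sum_{xy\in E}w_{xy}u(x,y)$ over all ultrametrics $u$ on $V$ (metrics with $u(x,y)\le\max\{u(x,z),u(z,y)\}$) with $u\ge d_G$ on all pairs. A rooted binary hierarchy $H$ on $V$ is a rooted tree whose leaves are the vertices of $V$ and whose internal nodes have exactly two children; $C_H(x,y)$ is the set of leaves below the lowest common ancestor of $x,y$; $h_H(x,x)=0$ and $h_H(x,y)=|C_H(x,y)|-1$ for $x\ne y$. $\operatorname{OPT}_{\mathrm{card}}(G,w)$ is the minimum of $\sum_{xy\in E}w_{xy}h_H(x,y)$ over all rooted binary hierarchies $H$ on $V$ with $h_H\ge d_G$ on all pairs. *)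

(* Defs.v *)
From HB Require Import structures.
From mathcomp Require Import all_boot all_order all_algebra.
From mathcomp Require Import classical_sets reals exp.

Set Implicit Arguments.
Unset Strict Implicit.
Unset Printing Implicit Defensive.

Import Order.TTheory GRing.Theory Num.Theory.
Local Open Scope ring_scope.

(* A simple graph on a finite type V is a symmetric irreflexive relation. *)

Definition induced (V : finType) (e : rel V) (S : {set V}) : rel V :=
  [rel x y | [&& x \in S, y \in S & e x y]].

Definition del_edge (V : finType) (e : rel V) (a b : V) : rel V :=
  [rel x y | e x y && ([set x; y] != [set a; b])%SET].

Definition connected_on (V : finType) (e : rel V) (S : {set V}) : Prop :=
  {in S &, forall x y, connect (induced e S) x y}.

(* Vertex sets of the connected components of the graph (S, r). *)
Definition components (V : finType) (r : rel V) (S : {set V}) : {set {set V}} :=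
  equivalence_partition (connect (induced r S)) S.

(* A cycle [:: x; y] merely runs back and forth along an edge, so the genuine
   cycles are those of size at least 3. *)
Definition is_tree (V : finType) (e : rel V) : Prop :=
  [/\ symmetric e, irreflexive e, connected_on e [set: V]
    & forall c : seq V, ucycle e c -> (size c <= 2)%N].

Definition max_degree_le (V : finType) (e : rel V) (D : nat) : Prop :=
  forall x, (#|[set y | e x y]%SET| <= D)%N.

(* The weight of the edge xy is w x y = w y x; the values of w on non-edges
   are never used. *)
Definition edge_weights (R : realType) (V : finType) (e : rel V)
    (w : V -> V -> R) : Prop :=
  (forall x y, w x y = w y x) /\ (forall x y, e x y -> 0 < w x y).

(* Sum over the unordered edges of r of a symmetric function F: the double sum
   meets every edge twice. *)
Definition edge_sum (R : realType) (V : finType) (r : rel V)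
    (F : V -> V -> R) : R :=
  (\sum_x \sum_(y | r x y) F x y) / 2.

Definition weight_in (R : realType) (V : finType) (e : rel V)
    (w : V -> V -> R) (S : {set V}) : R :=
  edge_sum (induced e S) w.

Definition cost (R : realType) (V : finType) (e : rel V)
    (w u : V -> V -> R) : R :=
  edge_sum e (fun x y => w x y * u x y).

(* Least k < #|V| such that a walk with k edges joins x to y (a shortest walk
   has fewer than #|V| edges); it is #|V| if x and y are not connected. *)
Definition gdist (V : finType) (e : rel V) (x y : V) : nat :=
  find (fun k => [exists p : k.-tuple V, path e x p && (last x p == y)])
       (iota 0 #|V|).

Definition dominates_gdist (R : realType) (V : finType) (e : rel V)
    (u : V -> V -> R) : Prop :=
  forall x y, (gdist e x y)%:R <= u x y.

Definition is_metric (R : realType) (V : finType) (u : V -> V -> R) : Prop :=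
  [/\ forall x y, 0 <= u x y,
      forall x y, u x y = 0 <-> x = y,
      forall x y, u x y = u y x
    & forall x y z, u x y <= u x z + u z y].

Definition is_ultrametric (R : realType) (V : finType) (u : V -> V -> R) :
    Prop :=
  is_metric u /\ forall x y z, u x y <= Num.max (u x z) (u z y).

(* For a connected graph the feasible costs form a nonempty set bounded below,
   whose infimum is attained; the same holds for OPT_card below. *)
Definition OPT_free (R : realType) (V : finType) (e : rel V)
    (w : V -> V -> R) : R :=
  inf [set cost e w u
        | u in [set u | is_ultrametric u /\ dominates_gdist e u]]%classic.

Inductive bintree (V : Type) : Type :=
  | Leaf of V
  | Node of bintree V & bintree V.

Fixpoint leaves (V : Type) (t : bintree V) : seq V :=
  match t with
  | Leaf x => [:: x]
  | Node l r => leaves l ++ leaves r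
  end.

(* Each vertex labels exactly one leaf. *)
Definition is_hierarchy (V : finType) (t : bintree V) : Prop :=
  perm_eq (leaves t) (enum V).

(* The subtree rooted at the lowest common ancestor of x and y. *)
Fixpoint lca (V : finType) (t : bintree V) (x y : V) : bintree V :=
  match t with
  | Leaf _ => t
  | Node l r =>
      if (x \in leaves l) && (y \in leaves l) then lca l x y
      else if (x \in leaves r) && (y \in leaves r) then lca r x y
      else t
  end.

Definition lca_cluster (V : finType) (t : bintree V) (x y : V) : {set V} :=
  [set z in leaves (lca t x y)]%SET.

Definition card_height (R : realType) (V : finType) (t : bintree V)
    (x y : V) : R :=
  if x == y then 0 else #|lca_cluster t x y|%:R - 1.

Definition OPT_card (R : realType) (V : finType) (e : rel V)
    (w : V -> V -> R) : R :=
  inf [set cost e w (card_height R t)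
        | t in [set t | is_hierarchy t
                        /\ dominates_gdist e (card_height R t)]]%classic.

Definition balanced_light_edge (R : realType) (V : finType) (e : rel V)
    (w : V -> V -> R) (D : nat) (L : R) (S : {set V}) : Prop :=
  exists a b : V, exists A B : {set V},
    [/\ induced e S a b,
        components (del_edge e a b) S = [set A; B]%SET,
        Num.max (#|A|%:R - 1) (#|B|%:R - 1)
          <= (1 - 1 / D%:R) * (#|S|%:R - 1) :> R
      & w a b <= L * (weight_in e w S / (#|S|%:R - 1))].

(* The set of weights of edges; it is finite, and nonempty in a tree with at
   least two vertices, so its sup and inf are its maximum and minimum. *)
Definition weight_values (R : realType) (V : finType) (e : rel V)
    (w : V -> V -> R) : set R :=
  [set c | exists x y, e x y /\ c = w x y]%classic.

Definition logb (R : realType) (b x : R) : R := ln x / ln b.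

(* Main.v *)
(* Every feasible ultrametric is at least 1 on each edge, so OPT_free is at
   least the total weight W(V). Conversely, cut recursively each cluster S at its
   edge e_S. In the resulting hierarchy e_S is the only edge with height
   |S| - 1 at the node S, and it costs w(e_S) (|S| - 1) <= Lambda W(S). The
   clusters of one level are disjoint, so a level costs at most Lambda W(V), and
   |S| - 1 shrinks by the factor 1 - 1/Delta, which bounds the number of levels
   by 1 + floor(log(n - 1)). The clusters are connected, hence a cluster with
   k vertices has diameter at most k - 1 and the hierarchy is feasible.
   In the bounded-ratio case a balanced edge exists because of the degree bound,
   and it is light because G[S] has at least |S| - 1 edges. *)

Require Import Defs.
From HB Require Import structures.
From mathcomp Require Import all_boot all_order all_algebra.
From mathcomp Require Import classical_sets reals exp.
(* fintype and finset come again so that their lemma names win over those of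
   classical_sets. *)
From mathcomp Require Import fintype finset ring lra zify.

Set Implicit Arguments.
Unset Strict Implicit.
Unset Printing Implicit Defensive.

Import Order.TTheory GRing.Theory Num.Theory.
Local Open Scope ring_scope.

(** * Reachability along a relation *)

Lemma connect_closed (V : finType) (r : rel V) (X : {pred V}) :
  (forall x y, x \in X -> r x y -> y \in X) ->
  forall x y, connect r x y -> x \in X -> y \in X.
Proof.
move=> clX x y /connectP[p]; elim: p x => [|z p IHp] x /=.
  by move=> _ ->.
by move=> /andP[rxz pz] yE xX; apply: IHp pz yE (clX _ _ xX rxz).
Qed.

(** Only the steps that start at a vertex reachable from [x] have to lie in [r']. This moves walks
    of a cut graph into one of its sides, or from one cut graph into another. *)
Lemma connect_sub_reachable (V : finType) (r r' : rel V) (x y : V) :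
  (forall u v, connect r x u -> r u v -> r' u v) ->
  connect r x y -> connect r' x y.
Proof.
move=> sub xy.
suff : y \in [pred z | connect r x z & connect r' x z] by case/andP.
apply: connect_closed xy _; last by rewrite inE !connect0.
move=> u v /andP[xu xu'] uv; rewrite inE.
rewrite (connect_trans xu (connect1 uv)) /=.
by apply: connect_trans xu' (connect1 _); apply: sub.
Qed.

Lemma inducedE (V : finType) (e : rel V) (S : {set V}) x y :
  induced e S x y = [&& x \in S, y \in S & e x y].
Proof. by []. Qed.

Lemma del_edgeE (V : finType) (e : rel V) (a b x y : V) :
  del_edge e a b x y = e x y && ([set x; y] != [set a; b])%SET.
Proof. by []. Qed.

(** * Cutting a tree at an edge *)

Section EdgeCut.
Variables (V : finType) (e : rel V).

(** For an edge [ab] of [G[S]] this is the component of [a] once [ab] is deleted. Swapping [a] and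
    [b] gives the other component, so sides are indexed by directed edges. *)
Definition side (S : {set V}) (a b : V) : {set V} :=
  [set x in S | connect (induced (del_edge e a b) S) a x]%SET.

Lemma del_edgeC a b : del_edge e b a = del_edge e a b.
Proof. by rewrite /del_edge setUC. Qed.

Hypothesis htree : is_tree e.

Let e_sym : symmetric e. Proof. by case: htree. Qed.
Let e_irr : irreflexive e. Proof. by case: htree. Qed.

Lemma connect_cut_sym S a b : connect_sym (induced (del_edge e a b) S).
Proof.
apply: sym_connect_sym => x y; rewrite !inducedE !del_edgeE.
by rewrite e_sym (setUC [set x]) andbCA.
Qed.

(** A simple path from [a] to [b] that avoids [ab] would close up with [ab] to a genuine cycle. *)
Lemma edge_cut S a b : e a b -> ~~ connect (induced (del_edge e a b) S) a b.
Proof.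
move=> eab; apply/negP => /connectP[p0 pp0 bE].
have {pp0} : path (del_edge e a b) a p0.
  by apply: sub_path pp0 => x y /and3P[].
move: bE => /[swap]; case/shortenP => p pp up _ bE.
case: htree => _ _ _ /(_ (a :: p)).
have cyc : ucycle e (a :: p).
  rewrite /ucycle up andbT /= rcons_path -bE e_sym eab andbT.
  by apply: sub_path pp => x y /andP[].
(* The bound on cycles leaves paths with at most one step: the empty one would make [ab] a loop, and
   a single step would be the deleted edge itself. *)
move=> /(_ cyc); case: p pp up bE cyc => [|c [|//]] /=.
  by move=> _ _ ba; rewrite ba e_irr in eab.
by move=> /andP[/andP[_ ne] _] _ bc; rewrite bc eqxx in ne.
Qed.

Section Sides.
Variables (S : {set V}) (a b : V).
Hypothesis ab : induced e S a b.

Let aS : a \in S. Proof. by case/and3P: ab. Qed.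
Let eab : e a b. Proof. by case/and3P: ab. Qed.

Lemma mem_side : a \in side S a b.
Proof. by rewrite inE aS connect0. Qed.

Lemma side_sub : side S a b \subset S.
Proof. by apply/subsetP => x; rewrite inE => /andP[]. Qed.

Lemma side_disjoint x : x \in side S a b -> x \in side S b a -> False.
Proof.
rewrite !inE (del_edgeC a b) => /andP[_ ax] /andP[_ bx].
case/negP: (edge_cut S eab); apply: connect_trans ax _.
by rewrite connect_cut_sym.
Qed.

(** A walk from [a] in the cut graph visits only vertices reachable from [a], so it never leaves the
    side. *)
Lemma side_connected : connected_on e (side S a b).
Proof.
have H x : x \in side S a b -> connect (induced e (side S a b)) a x.
  rewrite inE => /andP[_]; apply: connect_sub_reachable => u v au uv.
  have /and3P[uS vS /andP[euv _]] := uv.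
  by rewrite inducedE !inE uS vS au euv (connect_trans au (connect1 uv)).
move=> x y xA yA; apply: connect_trans (H _ yA).
rewrite sym_connect_sym; first exact: H.
by move=> u v; rewrite !inducedE e_sym andbCA.
Qed.
End Sides.

Section Split.
Variables (S : {set V}) (a b : V).
Hypotheses (cS : connected_on e S) (ab : induced e S a b).

Let ba : induced e S b a.
Proof. by case/and3P: ab => aS bS eab; rewrite inducedE aS bS e_sym. Qed.

(** The union of the sides is closed under the edges of [G[S]]: [ab] has both ends in it, and every
    other edge survives the deletion. *)
Lemma side_cover x : x \in S -> (x \in side S a b) || (x \in side S b a).
Proof.
move=> xS; have /and3P[aS bS eab] := ab.
suff : x \in side S a b :|: side S b a by rewrite inE.
apply: (connect_closed _ (cS aS xS)); last by rewrite inE mem_side.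
move=> u v; rewrite inE => uX /and3P[uS vS euv].
have [uvE|ne] := eqVneq [set u; v] [set a; b].
  have : v \in [set a; b] by rewrite -uvE !inE eqxx orbT.
  by rewrite !inE => /orP[] /eqP->; rewrite connect0 ?aS ?bS ?orbT.
have uv : induced (del_edge e a b) S u v.
  by rewrite inducedE del_edgeE uS vS euv ne.
move: uX; rewrite !inE uS vS (del_edgeC a b) /=.
by move=> /orP[] ux; rewrite (connect_trans ux (connect1 uv)) ?orbT.
Qed.

Lemma sideU : side S a b :|: side S b a = S.
Proof.
apply/setP => x; rewrite inE; apply/idP/idP; last exact: side_cover.
by case/orP => /(subsetP (side_sub _ _ _)).
Qed.

Lemma card_sides : (#|side S a b| + #|side S b a| = #|S|)%N.
Proof.
rewrite -[in RHS]sideU cardsU -[LHS]subn0; congr (_ - _)%N.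
apply/esym/eqP; rewrite cards_eq0; apply/eqP/setP => x.
rewrite !in_set0 in_setI.
by apply/andP => -[xA]; apply: side_disjoint xA.
Qed.

Lemma side_cross x y : x \in side S a b -> y \in side S b a -> e x y ->
  (x == a) && (y == b).
Proof.
move=> xA yB exy.
have [xyE|ne] := eqVneq [set x; y] [set a; b]; last first.
  have xS := subsetP (side_sub _ _ _) _ xA.
  have yS := subsetP (side_sub _ _ _) _ yB.
  case: (side_disjoint ab _ yB); move: xA; rewrite !inE yS => /andP[_ ax] /=.
  apply: connect_trans ax (connect1 _).
  by rewrite inducedE del_edgeE xS yS exy ne.
have aA := mem_side ab; have bB := mem_side ba.
have : x \in [set a; b] by rewrite -xyE !inE eqxx.
rewrite !inE => /orP[] /eqP xE; last first.
  by rewrite xE in xA; case: (side_disjoint ab xA bB).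
have : y \in [set a; b] by rewrite -xyE !inE eqxx orbT.
rewrite !inE => /orP[] /eqP yE.
  by rewrite yE in yB; case: (side_disjoint ab aA yB).
by rewrite xE yE !eqxx.
Qed.

(** This identifies the unnamed components [A] and [B] of [balanced_light_edge] with the two
    sides. *)
Lemma components_cut :
  components (del_edge e a b) S = [set side S a b; side S b a]%SET.
Proof.
have /and3P[aS bS eab] := ab.
have csym := connect_cut_sym S a b.
apply/setP => X; rewrite !inE; apply/imsetP/idP => [[x xS ->]|].
  have /orP[] := side_cover xS; rewrite inE ?(del_edgeC a b) xS /= => xX.
    apply/orP; left; apply/eqP/setP => y; rewrite !inE.
    by congr (_ && _); rewrite (same_connect csym xX).
  apply/orP; right; apply/eqP/setP => y; rewrite !inE ?(del_edgeC a b).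
  by congr (_ && _); rewrite (same_connect csym xX).
case/orP => /eqP->; first by exists a.
by exists b => //; rewrite /side del_edgeC.
Qed.

(** Every edge of [G[S]] other than [ab] lies inside exactly one side. *)
Lemma edge_sum_split (R : realType) (F : V -> V -> R) :
  (forall x y, F x y = F y x) ->
  edge_sum (induced e S) F =
  edge_sum (induced e (side S a b)) F + edge_sum (induced e (side S b a)) F
  + F a b.
Proof.
move=> Fsym.
(* Writing the two orientations of [ab] as double sums too lets the identity be checked separately
   for each pair of vertices. *)
have pick u v : \sum_x \sum_y (if (x == u) && (y == v) then F x y else 0)
    = F u v.
  rewrite (bigD1 u) //= [X in _ + X]big1 => [|x /negPf-> /=]; last first.
    by rewrite big1.
  rewrite (bigD1 v) //= [X in _ + X + _]big1 ?eqxx ?addr0 // => y /negPf->.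
  by rewrite andbF.
have key : \sum_x \sum_(y | induced e S x y) F x y =
    \sum_x \sum_(y | induced e (side S a b) x y) F x y
    + \sum_x \sum_(y | induced e (side S b a) x y) F x y
    + (F a b + F b a).
  rewrite -(pick a b) -(pick b a) -!big_split /=; apply: eq_bigr => x _.
  rewrite big_mkcond [X in _ = X + _ + _]big_mkcond.
  rewrite [X in _ = _ + X + _]big_mkcond -!big_split /=; apply: eq_bigr => y _.
  rewrite !inducedE.
  have SE z : (z \in S) = (z \in side S a b) || (z \in side S b a).
    by rewrite -[in LHS]sideU inE.
  have dis z : (z \in side S a b) && (z \in side S b a) = false.
    by apply/andP => -[zA]; apply: side_disjoint.
  have aA := mem_side ab; have bB := mem_side ba; have /and3P[_ _ eab] := ab.
  have aB : (a \in side S b a) = false by have := dis a; rewrite aA.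
  have bA : (b \in side S a b) = false by have := dis b; rewrite bB andbT.
  have crossl := @side_cross x y; have crossr := @side_cross y x.
  rewrite (e_sym y x) in crossr.
  have [|nab] := boolP ((x == a) && (y == b)).
    case/andP => /eqP xE /eqP yE; rewrite {}xE {}yE in crossl crossr *.
    rewrite SE SE aA bB aB bA eab /=.
    have -> : (a == b) = false by apply/eqP => abE; rewrite abE e_irr in eab.
    by rewrite !add0r addr0.
  have [|nba] := boolP ((x == b) && (y == a)).
    case/andP => /eqP xE /eqP yE; rewrite {}xE {}yE in crossl crossr nab *.
    by rewrite SE SE aA bB aB bA e_sym eab /= !add0r.
  rewrite (negPf nab) in crossl; rewrite andbC (negPf nba) in crossr.
  rewrite !SE; have := dis x; have := dis y.
  case: (x \in side S a b) crossl crossr => crossl crossr;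
  case: (x \in side S b a) crossl crossr => crossl crossr;
  case: (y \in side S a b) crossl crossr => crossl crossr;
  case: (y \in side S b a) crossl crossr => crossl crossr //= _ _;
  case: (e x y) crossl crossr => crossl crossr; rewrite ?addr0 ?add0r //.
  - by have := crossl isT isT isT.
  - by have := crossr isT isT isT.
by rewrite /edge_sum key (Fsym b a); field.
Qed.
End Split.

(** * Weight bounds and balanced edges in connected vertex sets *)

Lemma connected_edge (S : {set V}) : connected_on e S -> (2 <= #|S|)%N ->
  exists a b, induced e S a b.
Proof.
move=> cS /card_gt1P[x [y [xS yS xy]]].
have /connectP[[|z p] /=] := cS x y xS yS.
  by move=> _ yx; rewrite yx eqxx in xy.
by move=> /andP[xz _] _; exists x, z.
Qed.

Lemma edge_sum_induced1 (R : realType) (F : V -> V -> R) x :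
  edge_sum (induced e [set x]) F = 0.
Proof.
rewrite /edge_sum big1 ?mul0r // => y _; rewrite big1 // => z.
by rewrite inducedE !inE => /and3P[/eqP-> /eqP->]; rewrite e_irr.
Qed.

(** Cutting at any edge and inducting on the size counts the [|S| - 1] edges of the tree [G[S]]. The
    bound serves twice: for positivity of the total weight, and for lightness in the bounded-ratio
    case. *)
Lemma connected_weight_ge (R : realType) (w : V -> V -> R) (c : R)
    (S : {set V}) :
  (forall x y, w x y = w y x) -> (forall x y, e x y -> c <= w x y) ->
  connected_on e S -> (0 < #|S|)%N -> c * (#|S|%:R - 1) <= weight_in e w S.
Proof.
move=> wsym wc; have [n] := ubnP #|S|.
elim: n S => // n IHn S; rewrite ltnS => Sn cS S0.
have [S1|S2] := leqP #|S| 1.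
  have /cards1P[x ->] : #|S| == 1%N by rewrite eqn_leq S1.
  by rewrite cards1 subrr mulr0 /weight_in edge_sum_induced1.
have [a [b ab]] := connected_edge cS S2.
have /and3P[aS bS eab] := ab.
have ba : induced e S b a by rewrite inducedE aS bS e_sym.
have A0 : (0 < #|side S a b|)%N by apply/card_gt0P; exists a; apply: mem_side.
have B0 : (0 < #|side S b a|)%N by apply/card_gt0P; exists b; apply: mem_side.
have cAB := card_sides cS ab.
have An : (#|side S a b| < n)%N by lia.
have Bn : (#|side S b a| < n)%N by lia.
have IA := IHn _ An (@side_connected S a b) A0.
have IB := IHn _ Bn (@side_connected S b a) B0.
rewrite /weight_in (edge_sum_split cS ab wsym) -cAB natrD.
have := wc _ _ eab; rewrite /weight_in in IA IB; lra.
Qed.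

(* Among the directed edges whose tail side is too large, take one, ab, whose
   tail side A is smallest. The components of A - a at the at most D - 1 other
   neighbours c of a cover A - a, so one of them has more than (|S| - 1) / D
   vertices; the complement of that one is small enough, and it is itself small
   enough by minimality of A. *)
Lemma balanced_edge (D : nat) (S : {set V}) : max_degree_le e D ->
  connected_on e S -> (2 <= #|S|)%N ->
  exists a b, [/\ induced e S a b,
    (D * #|side S a b|.-1 <= D.-1 * #|S|.-1)%N
    & (D * #|side S b a|.-1 <= D.-1 * #|S|.-1)%N].
Proof.
move=> hdeg cS S2.
pose big := [pred p : V * V | induced e S p.1 p.2
  & (D.-1 * #|S|.-1 < D * #|side S p.1 p.2|.-1)%N].
have bigN u v : induced e S u v -> ~~ big (u, v) ->
    (D * #|side S u v|.-1 <= D.-1 * #|S|.-1)%N.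
  by move=> /= ->; rewrite /= -leqNgt.
have revS u v : induced e S u v -> induced e S v u.
  by move=> /and3P[uS vS uv]; rewrite inducedE uS vS e_sym.
(* If no side is too large, any edge of [G[S]] is balanced. *)
have [[a0 b0] big0|nobig] := pickP big; last first.
  have [a [b ab]] := connected_edge cS S2.
  have ba := revS _ _ ab.
  by exists a, b; split=> //; apply: bigN => //; apply: negbT; apply: nobig.
case: (arg_minnP (fun p => #|side S p.1 p.2|) big0).
move=> -[a b] /andP[/= ab bigA] minA.
have /and3P[aS bS eab] := ab.
set A := side S a b in bigA minA.
pose N := [set c in S | e a c && (c != b)]%SET.
have NA c : c \in N -> induced e S a c.
  by rewrite inE inducedE aS => /and3P[-> ->].
have Nsub c : c \in N -> side S c a \subset A :\ a.
  move=> cN; have ac := NA c cN; have ca := revS _ _ ac.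
  have /and3P[_ cS' eac] := ac.
  have cb : c != b by move: cN; rewrite inE => /and3P[].
  apply/subsetP => x xC; rewrite in_setD1; apply/andP; split.
    apply/eqP => xa; rewrite xa in xC.
    exact: (side_disjoint ca xC (mem_side ac)).
  move: xC; rewrite !inE => /andP[-> cx] /=.
  have a_cb : induced (del_edge e a b) S a c.
    rewrite inducedE del_edgeE aS cS' eac /=; apply/eqP => E.
    have : c \in [set a; b] by rewrite -E !inE eqxx orbT.
    by rewrite !inE (negPf cb) orbF => /eqP ca'; rewrite ca' e_irr in eac.
  apply: connect_trans (connect1 a_cb) _.
  apply: connect_sub_reachable cx => u v cu uv.
  have /and3P[uS vS /andP[euv _]] := uv.
  (* The cut separates [c] from [a], so a walk from [c] in its side never meets [a] and cannot use
     [ab]. *)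
  have na z : connect (induced (del_edge e c a) S) c z -> z != a.
    move=> cz; apply/eqP => za; rewrite za in cz.
    by case/negP: (edge_cut S (a := c) (b := a) (etrans (e_sym _ _) eac)).
  rewrite inducedE del_edgeE uS vS euv /=; apply/eqP => E.
  have : a \in [set u; v] by rewrite E !inE eqxx.
  rewrite !inE ![a == _]eq_sym (negPf (na _ cu)) /=.
  by rewrite (negPf (na _ (connect_trans cu (connect1 uv)))).
have Acov : A :\ a \subset \bigcup_(c in N) side S c a.
  apply/subsetP => x; rewrite in_setD1 => /andP[xa].
  rewrite inE => /andP[xS /connectP[p0 pp0 xE]].
  move: xE; case/shortenP: pp0 => p; case: p => [_ _ _ /= xE|].
    by rewrite xE eqxx in xa.
  move=> c p /= /andP[ac pp] /andP[ap up] _ xE.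
  have /and3P[_ cS' /andP[eac ne]] := ac.
  apply/bigcupP; exists c.
    by rewrite inE cS' eac /=; apply/eqP => cb; rewrite cb eqxx in ne.
  rewrite inE xS /=; apply/connectP; exists p => //.
  (* The path is simple, so after its first step to [c] it does not return to [a]; its tail
     therefore avoids the edge [ca]. *)
  have nac : all [pred z | z != a] (c :: p).
    by apply/allP => z zp /=; apply: contraNneq ap => <-.
  apply: sub_in_path nac pp => u v ua va /and3P[uS vS /andP[euv _]].
  rewrite inducedE del_edgeE uS vS euv /=; apply/eqP => E.
  have : a \in [set u; v] by rewrite E !inE eqxx orbT.
  by rewrite !inE ![a == _]eq_sym (negPf ua) (negPf va).
have cA : #|A :\ a| = #|A|.-1 by rewrite (cardsD1 a A) (mem_side ab).
have cN : (#|N| <= D.-1)%N.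
  (* The neighbour [b] of [a] is left out of [N], which turns the degree bound [D] into [D.-1]. *)
  have sub : N \subset [set y | e a y]%SET :\ b.
    by apply/subsetP => c; rewrite !inE => /and3P[_ -> ->].
  apply: leq_trans (subset_leq_card sub) _.
  by have := hdeg a; rewrite (cardsD1 b) inE eab; case: (D).
have [c cNi Cbig] : exists2 c, c \in N & (#|S|.-1 < D * #|side S c a|)%N.
  apply/exists_inP; apply: contraLR bigA.
  rewrite negb_exists_in => /forall_inP H.
  rewrite -leqNgt -cA.
  have : (#|A :\ a| <= \sum_(c in N) #|side S c a|)%N.
    apply: leq_trans (subset_leq_card Acov) _.
    elim/big_rec2: _ => [|c m X _ le]; first by rewrite cards0.
    by apply: leq_trans (leq_card_setU _ _) _; rewrite leq_add2l.
  move=> /(leq_mul (leqnn D)) /leq_trans; apply; rewrite big_distrr /=.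
  apply: (@leq_trans (\sum_(c in N) #|S|.-1)%N).
    by apply: leq_sum => c cN'; rewrite leqNgt H.
  by rewrite sum_nat_const leq_mul2r cN orbT.
have ac := NA c cNi; have ca := revS _ _ ac.
have cardC := card_sides cS ca.
exists c, a; split=> //.
  apply: bigN => //; apply/negP => /minA /=.
  have := subset_leq_card (Nsub c cNi); rewrite cA.
  by have : (0 < #|A|)%N by [apply/card_gt0P; exists a; apply: mem_side]; lia.
have Ac0 : (0 < #|side S a c|)%N by apply/card_gt0P; exists a; apply: mem_side.
(* After this substitution the claim amounts to [#|S|.-1 <= D * #|side S c a|], which [Cbig]
   provides. *)
have -> : #|side S a c|.-1 = (#|S|.-1 - #|side S c a|)%N by lia.
rewrite mulnBr leq_subLR; case: (D) Cbig => [|d Cbig]; first by rewrite mul0n.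
by rewrite mulSn leq_add2r ltnW.
Qed.

Lemma side_card_le (R : realType) (D : nat) (S : {set V}) (a b : V) :
  (0 < D)%N -> induced e S a b ->
  (D * #|side S a b|.-1 <= D.-1 * #|S|.-1)%N ->
  #|side S a b|%:R - 1 <= (1 - 1 / D%:R) * (#|S|%:R - 1) :> R.
Proof.
move=> D0 ab le; have /and3P[aS _ _] := ab.
have A0 : (0 < #|side S a b|)%N by apply/card_gt0P; exists a; apply: mem_side.
have S0 : (0 < #|S|)%N by apply/card_gt0P; exists a.
have pr n : (0 < n)%N -> n.-1%:R = n%:R - 1 :> R.
  by case: n => //= n _; rewrite -natr1 addrK.
have DE : D%:R * (1 - 1 / D%:R) = D.-1%:R :> R.
  by rewrite pr //; field; rewrite pnatr_eq0 -lt0n.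
by rewrite -(@ler_pM2l _ D%:R) ?ltr0n // mulrA DE -!pr // -!natrM ler_nat.
Qed.
End EdgeCut.

(** * Graph distance *)

(** [find] stops at the first admissible length. If it went past [size p], then [size p] would be
    among the tested lengths and [p] would witness an earlier stop. *)
Lemma gdist_le (V : finType) (e : rel V) (x : V) (p : seq V) :
  path e x p -> (gdist e x (last x p) <= size p)%N.
Proof.
move=> xp; rewrite leqNgt; apply/negP => lt.
have := before_find 0%N lt.
have : (size p < #|V|)%N.
  apply: leq_trans lt _; rewrite /gdist.
  by apply: leq_trans (find_size _ _) _; rewrite size_iota.
move=> pV; rewrite nth_iota // add0n => /negbT/negP[].
by apply/existsP; exists (in_tuple p); rewrite /= xp eqxx.
Qed.

Lemma gdist_le_card (V : finType) (e : rel V) x y : (gdist e x y <= #|V|)%N.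
Proof. by rewrite -[leqRHS](size_iota 0) find_size. Qed.

Lemma gdistxx (V : finType) (e : rel V) x : gdist e x x = 0%N.
Proof. by apply/eqP; rewrite -leqn0 (@gdist_le _ _ _ [::]). Qed.

Lemma gdist_gt0 (V : finType) (e : rel V) x y : x != y -> (0 < gdist e x y)%N.
Proof.
move=> xy; rewrite lt0n; apply/eqP => d0.
have V0 : (0 < #|V|)%N by apply/card_gt0P; exists x.
have := @nth_find _ 0%N
  (fun k => [exists p : k.-tuple V, path e x p && (last x p == y)])
  (iota 0 #|V|).
rewrite has_find size_iota -/(gdist e x y) d0 V0 nth_iota // => /(_ isT).
by case/existsP => p; rewrite tuple0 /= (negPf xy).
Qed.

(** A walk inside [C] without repeated vertices has at most [#|C| - 1] edges, which is exactly the
    height of a node with cluster [C]. *)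
Lemma gdist_connected_on (V : finType) (e : rel V) (C : {set V}) x y :
  connected_on e C -> x \in C -> y \in C -> (gdist e x y < #|C|)%N.
Proof.
move=> cC xC yC; have /connectP[p0 pp0 yE] := cC x y xC yC.
move: yE; case/shortenP: pp0 => p pp up _ yE.
have pC : {subset x :: p <= C}.
  move=> z; rewrite inE => /orP[/eqP->//|]; move: pp; clear -xC.
  elim: p x xC => // u p IHp x xC /= /andP[/and3P[_ uC _] pp].
  by rewrite inE => /orP[/eqP->//|]; exact: IHp uC pp.
have : (gdist e x y <= size p)%N.
  rewrite yE; apply: gdist_le; apply: sub_path pp => u v.
  by case/and3P.
move=> /leq_ltn_trans; apply.
rewrite -[(size p).+1]/(size (x :: p)) -(card_uniqP up).
exact/subset_leq_card/subsetP.
Qed.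

(** * Clusters and heights in a hierarchy *)

Section Hierarchy.
Variables (R : realType) (V : finType).
Implicit Types (t l r : bintree V) (x y : V).

Lemma lcaC t x y : lca t x y = lca t y x.
Proof.
elim: t => //= l IHl r IHr.
by rewrite IHl IHr [(y \in leaves l) && _]andbC [(y \in leaves r) && _]andbC.
Qed.

Lemma card_heightC t x y : card_height R t x y = card_height R t y x.
Proof. by rewrite /card_height eq_sym /lca_cluster lcaC. Qed.

Lemma mem_lca t x y : x \in leaves t -> y \in leaves t ->
  (x \in leaves (lca t x y)) && (y \in leaves (lca t x y)).
Proof.
elim: t => [z|l IHl r IHr] /= xt yt; first by rewrite xt yt.
case: ifP => [/andP[]|_]; first exact: IHl.
case: ifP => [/andP[]|_]; first exact: IHr.
by rewrite /= xt yt.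
Qed.
End Hierarchy.

(** * Comparing sums over edges *)

Lemma edge_sum_eq (R : realType) (V : finType) (r : rel V) (F G : V -> V -> R) :
  (forall x y, r x y -> F x y = G x y) -> edge_sum r F = edge_sum r G.
Proof.
move=> FG; rewrite /edge_sum; congr (_ / _).
by apply: eq_bigr => x _; apply: eq_bigr => y; apply: FG.
Qed.

Lemma edge_sum_le (R : realType) (V : finType) (r : rel V) (F G : V -> V -> R) :
  (forall x y, r x y -> F x y <= G x y) -> edge_sum r F <= edge_sum r G.
Proof.
move=> FG; rewrite /edge_sum ler_pM2r ?invr_gt0 ?ltr0n //.
by apply: ler_sum => x _; apply: ler_sum => y; apply: FG.
Qed.

Lemma edge_sum_ge0 (R : realType) (V : finType) (r : rel V) (F : V -> V -> R) :
  (forall x y, r x y -> 0 <= F x y) -> 0 <= edge_sum r F.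
Proof.
move=> F0; rewrite /edge_sum divr_ge0 //.
by apply: sumr_ge0 => x _; apply: sumr_ge0 => y; apply: F0.
Qed.

Lemma weight_in_setT (R : realType) (V : finType) (e : rel V)
    (w : V -> V -> R) :
  weight_in e w [set: V] = edge_sum e w.
Proof.
rewrite /weight_in /edge_sum; congr (_ / _).
by apply: eq_bigr => x _; apply: eq_bigl => y; rewrite inducedE !inE.
Qed.

(** * The hierarchy obtained by recursive cutting *)

(** Induction on [m], which bounds the number of levels with a cut. Connectedness of the clusters is
    carried along because feasibility will follow from it. *)
Lemma hierarchy_exists (R : realType) (V : finType) (e : rel V)
    (w : V -> V -> R) (D : nat) (L : R) (m : nat) (S : {set V}) :
  (2 <= D)%N -> 0 <= L -> is_tree e -> edge_weights e w ->
  (forall S : {set V}, connected_on e S -> (2 <= #|S|)%N ->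
      balanced_light_edge e w D L S) ->
  connected_on e S -> (0 < #|S|)%N ->
  #|S|%:R - 1 < (D%:R / (D%:R - 1)) ^+ m :> R ->
  exists t, [/\ uniq (leaves t), leaves t =i S,
    {in S &, forall x y, connected_on e (lca_cluster t x y)}
    & edge_sum (induced e S) (fun x y => w x y * card_height R t x y)
      <= L * m%:R * weight_in e w S].
Proof.
move=> D2 L0 htree [wsym wpos] bal.
have D1 : 1 < D%:R :> R by rewrite ltr1n.
have e_sym : symmetric e by case: htree.
pose good k (T : {set V}) := exists t, [/\ uniq (leaves t), leaves t =i T,
    {in T &, forall x y, connected_on e (lca_cluster t x y)}
    & edge_sum (induced e T) (fun x y => w x y * card_height R t x y)
      <= L * k%:R * weight_in e w T].
have leaf k T : connected_on e T -> (0 < #|T|)%N -> (#|T| <= 1)%N -> good k T.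
  move=> cT T0 T1; have /cards1P[z TE] : #|T| == 1%N by rewrite eqn_leq T1.
  have clusterE : [set u in leaves (Leaf z)] = T.
    by rewrite TE; apply/setP => u; rewrite !inE.
  exists (Leaf z); split=> // [x|x y _ _|]; first by rewrite TE !inE.
    by rewrite /lca_cluster clusterE.
  by rewrite TE /weight_in !edge_sum_induced1 // mulr0.
rewrite -/(good m S); elim: m S => [|m IHm] S cS S0 Sm.
  (* For exponent 0 the hypothesis reads [|S| - 1 < 1], so [S] is a single vertex. *)
  apply: leaf => //; move: Sm; rewrite expr0 ltrBlDr -[1 + 1]/(2%:R) ltr_nat.
  by rewrite ltnS.
have [S1|S2] := leqP #|S| 1; first exact: leaf.
have [a [b [A [B [ab compE balAB lightab]]]]] := bal S cS S2.
have /and3P[aS bS eab] := ab.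
have ba : induced e S b a by rewrite inducedE aS bS e_sym.
rewrite (components_cut htree cS ab) in compE.
have bound X : X \in [set side e S a b; side e S b a] ->
    #|X|%:R - 1 < (D%:R / (D%:R - 1)) ^+ m :> R.
  rewrite compE !inE => XAB.
  have : #|X|%:R - 1 <= (1 - 1 / D%:R) * (#|S|%:R - 1) :> R.
    apply: le_trans balAB; rewrite le_max.
    by case/orP: XAB => /eqP->; rewrite lexx ?orbT.
  move=> /le_lt_trans; apply.
  (* The balance factor is the inverse of the base of the power, so one cut lowers the exponent by
     one. *)
  have -> : 1 - 1 / D%:R = (D%:R / (D%:R - 1))^-1 :> R.
    by field; apply/andP; split; lra.
  have q0 : 0 < D%:R / (D%:R - 1) :> R by apply: divr_gt0; lra.
  by rewrite mulrC ltr_pdivrMr // -exprSr.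
have cA := @side_connected _ _ htree S a b.
have cB := @side_connected _ _ htree S b a.
have A0 : (0 < #|side e S a b|)%N.
  by apply/card_gt0P; exists a; apply: mem_side ab.
have B0 : (0 < #|side e S b a|)%N.
  by apply/card_gt0P; exists b; apply: mem_side ba.
have [|l [ul lE lconn lcost]] := IHm _ cA A0.
  by apply: bound; rewrite !inE eqxx.
have [|r [ur rE rconn rcost]] := IHm _ cB B0.
  by apply: bound; rewrite !inE eqxx orbT.
have disAB x : x \in side e S a b -> (x \in side e S b a) = false.
  by move=> xA; apply/negP; apply: side_disjoint xA.
have disBA x : x \in side e S b a -> (x \in side e S a b) = false.
  by move=> xB; apply/negP => xA; rewrite disAB in xB.
have tE : leaves (Node l r) =i S.
  by move=> x; rewrite /= mem_cat lE rE -[in RHS](sideU cS ab) in_setU.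
have clusterS : [set z in leaves (Node l r)] = S.
  by apply/setP => z; rewrite inE tE.
exists (Node l r); split => //.
- rewrite /= cat_uniq ul ur andbT /=; apply/hasPn => x /=.
  by rewrite lE rE => /disBA->.
- move=> x y xS yS; rewrite /lca_cluster /= !lE !rE.
  case: ifP => [/andP[xA yA]|_]; first exact: lconn.
  by case: ifP => [/andP[xB yB]|_]; [exact: rconn | rewrite clusterS].
have wlsym (f : bintree V) x y :
    w x y * card_height R f x y = w y x * card_height R f y x.
  by rewrite wsym card_heightC.
rewrite (edge_sum_split htree cS ab (wlsym _)) /weight_in.
rewrite (edge_sum_split htree cS ab wsym).
rewrite (@edge_sum_eq _ _ (induced e (side e S a b)) _
  (fun x y => w x y * card_height R l x y)); last first.
  by move=> x y /and3P[xA yA _]; rewrite /card_height /lca_cluster /= !lE xA yA.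
rewrite (@edge_sum_eq _ _ (induced e (side e S b a)) _
  (fun x y => w x y * card_height R r x y)); last first.
  move=> x y /and3P[xB yB _].
  by rewrite /card_height /lca_cluster /= !lE !rE (disBA _ xB) xB yB.
(* The ends of the cut edge lie in different subtrees, so their lowest common ancestor is the root,
   with cluster [S]. *)
have -> : card_height R (Node l r) a b = #|S|%:R - 1.
  have aA := mem_side ab; have bB := mem_side ba.
  rewrite /card_height /lca_cluster /= !lE !rE bB (disBA _ bB) (disAB _ aA).
  rewrite andbF clusterS; case: eqP => // abE.
  by case: htree => _ e_irr _ _; rewrite abE e_irr in eab.
have S1 : 0 < #|S|%:R - 1 :> R by rewrite subr_gt0 ltr1n.
have := lightab; rewrite mulrA ler_pdivlMr // /weight_in.
rewrite (edge_sum_split htree cS ab wsym).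
rewrite /weight_in in lcost rcost.
set WA := edge_sum _ w in lcost *; set WB := edge_sum _ w in rcost *.
move=> light; rewrite -natr1.
(* The deeper levels are charged only to the weights inside the sides, whereas [W(S)] also contains
   [w a b]; this is the resulting slack. *)
have Lm : 0 <= L * m%:R * w a b by rewrite !mulr_ge0 // ltW // wpos.
lra.
Qed.

(** * Bounds on the two optima *)

(** A common lower bound passes to [inf] only for a nonempty set, so a feasible ultrametric is
    exhibited first. *)
Lemma OPT_free_ge (R : realType) (V : finType) (e : rel V) (w : V -> V -> R) :
  irreflexive e -> edge_weights e w -> edge_sum e w <= OPT_free e w.
Proof.
move=> e_irr [wsym wpos]; apply: lb_le_inf.
  (* The constant [#|V|] dominates every value of [gdist], including its default for unconnected
     vertices. *)
  pose u (x y : V) : R := if x == y then 0 else #|V|%:R.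
  have u0 x y : 0 <= u x y by rewrite /u; case: eqP.
  have umax x y z : u x y <= Num.max (u x z) (u z y).
    rewrite /u; case: (eqVneq x y) => [_|xy].
      by rewrite le_max; case: ifP => _; rewrite ?lexx ?ler0n.
    rewrite le_max; case: (eqVneq x z) xy => [->|_] xy; last by rewrite lexx.
    by rewrite (negPf xy) lexx orbT.
  exists (cost e w u), u => //; split.
    split; last exact: umax.
    split=> // [x y|x y|x y z].
    - rewrite /u; split=> [|->]; last by rewrite eqxx.
      case: eqP => // _ /eqP; rewrite pnatr_eq0 => /eqP/card0_eq/(_ x).
      by rewrite inE.
    - by rewrite /u eq_sym.
    - by apply: le_trans (umax x y z) _; rewrite ge_max lerDl lerDr !u0.
  move=> x y; rewrite /u; case: eqP => [->|_]; first by rewrite gdistxx.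
  by rewrite ler_nat gdist_le_card.
move=> _ [u [_ dom] <-]; apply: edge_sum_le => x y exy.
apply: ler_peMr; first exact/ltW/wpos.
apply: le_trans (dom x y).
by rewrite ler1n gdist_gt0 //; apply/eqP => xy; rewrite xy e_irr in exy.
Qed.

(** [inf] lies below a member once the set is bounded below. Here 0 is a bound, since feasible
    heights dominate distances. *)
Lemma OPT_card_le (R : realType) (V : finType) (e : rel V) (w : V -> V -> R)
    (t : bintree V) :
  edge_weights e w -> is_hierarchy t -> dominates_gdist e (card_height R t) ->
  OPT_card e w <= cost e w (card_height R t).
Proof.
move=> [_ wpos] ht dom; apply: ge_inf; last by exists t.
exists 0 => _ [s [_ doms] <-]; apply: edge_sum_ge0 => x y exy.
by apply: mulr_ge0; [exact/ltW/wpos | apply: le_trans (doms x y)].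
Qed.

(** * The logarithm and the extreme edge weights *)

(** This supplies the number of levels: since [x >= 1] the floor is a natural number, and its
    successor exceeds the logarithm. *)
Lemma pow_gt_floor_logb (R : realType) (b x : R) : 1 < b -> 1 <= x ->
  exists2 m : nat, x < b ^+ m & m%:R = 1 + (Num.floor (logb b x))%:~R :> R.
Proof.
move=> b1 x1.
have lnb : 0 < ln b by rewrite ln_gt0.
have : 0 <= Num.floor (logb b x).
  by rewrite floor_ge0 divr_ge0 ?ln_ge0 // ltW.
case kE: (Num.floor (logb b x)) => [k|//] _; exists k.+1; last first.
  by rewrite -natr1 addrC.
have := floorD1_gt (logb b x); rewrite kE /logb ltr_pdivrMr // => lt.
rewrite -ltr_ln ?posrE ?exprn_gt0 //; try lra.
by rewrite lnXn ?(lt_trans ltr01) // -mulr_natl -natr1; move: lt; rewrite intrD.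
Qed.

Lemma min_edge_weight_gt0 (R : realType) (V : finType) (e : rel V)
    (w : V -> V -> R) : edge_weights e w ->
  exists2 c : R, 0 < c & forall x y, e x y -> c <= w x y.
Proof.
move=> [_ wpos].
(* The starting value 1 keeps the minimum positive even if there is no edge. *)
exists (\big[Num.min/1]_(p : V * V | e p.1 p.2) w p.1 p.2).
  by elim/big_ind: _ => // [x y x0 y0|p /wpos//]; rewrite lt_min x0.
by move=> x y exy; apply: (bigmin_inf (x, y)).
Qed.

(** A crude bound, enough to make the set of weights bounded above so that [sup] dominates them. *)
Lemma edge_weight_le_sum (R : realType) (V : finType) (e : rel V)
    (w : V -> V -> R) x y : edge_weights e w -> e x y ->
  w x y <= \sum_(p : V * V | e p.1 p.2) w p.1 p.2.
Proof.
move=> [_ wpos] exy; rewrite (bigD1 (x, y)) //= lerDl.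
by apply: sumr_ge0 => p /andP[/wpos/ltW].
Qed.

(** * The bound on the ratio and its two cases *)

Lemma OPT_ratio_le (R : realType) (D : nat) (L : R) (V : finType) (e : rel V)
    (w : V -> V -> R) :
  (2 <= D)%N -> (2 <= #|V|)%N -> is_tree e -> edge_weights e w ->
  (forall S : {set V}, connected_on e S -> (2 <= #|S|)%N ->
      balanced_light_edge e w D L S) ->
  OPT_card e w / OPT_free e w
    <= L * (1 + (Num.floor (logb (D%:R / (D%:R - 1) : R) (#|V|%:R - 1)))%:~R).
Proof.
move=> D2 V2 htree hw bal; have [wsym wpos] := hw.
have [e_sym e_irr cV _] := htree.
have D1 : 1 < D%:R :> R by rewrite ltr1n.
have V1 : 1 <= #|V|%:R - 1 :> R.
  by rewrite lerBrDr -[1 + 1]/(2%:R) ler_nat.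
have T2 : (2 <= #|[set: V]|)%N by rewrite cardsT.
have T0 : (0 < #|[set: V]|)%N by rewrite cardsT ltnW.
have [c c0 wc] := min_edge_weight_gt0 hw.
have W0 : 0 < edge_sum e w.
  rewrite -weight_in_setT.
  apply: lt_le_trans (connected_weight_ge htree wsym wc cV T0).
  by rewrite mulr_gt0 // cardsT; lra.
(* At [S = V] a positive weight is at most [L] times a positive quantity, which forces the sign of
   [L]. *)
have L0 : 0 <= L.
  have [a [b [_ [_ [/and3P[_ _ eab] _ _]]]]] := bal _ cV T2.
  rewrite weight_in_setT cardsT => /(lt_le_trans (wpos _ _ eab)).
  by rewrite pmulr_lgt0; [exact: ltW | apply: divr_gt0 => //; lra].
have q1 : 1 < D%:R / (D%:R - 1) :> R by rewrite ltr_pdivlMr; lra.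
have [m Vm <-] := pow_gt_floor_logb q1 V1.
rewrite -cardsT in Vm.
have [t [ut tE tconn tcost]] := hierarchy_exists D2 L0 htree hw bal cV T0 Vm.
have free := OPT_free_ge e_irr hw.
rewrite ler_pdivrMr; last exact: lt_le_trans free.
apply: le_trans (_ : L * m%:R * edge_sum e w <= _); last first.
  by rewrite ler_wpM2l // mulr_ge0.
have memt x : x \in leaves t by rewrite tE inE.
apply: le_trans (_ : cost e w (card_height R t) <= _).
  apply: OPT_card_le => //.
    by apply: uniq_perm => // [|x]; rewrite ?enum_uniq // mem_enum memt.
  move=> x y; rewrite /card_height; case: eqP => [->|_].
    by rewrite gdistxx.
  (* Feasibility: [x] and [y] lie in the connected cluster of their lowest common ancestor, so their
     distance is below its cardinality. *)
  have /andP[xC yC] := mem_lca (memt x) (memt y).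
  rewrite lerBrDr natr1 ler_nat; apply: gdist_connected_on; rewrite ?inE //.
  by apply: tconn; rewrite inE.
by move: tcost; rewrite -/(weight_in e _ [set: V]) !weight_in_setT.
Qed.

(** Lightness is the chain [w a b <= sup <= L * inf <= L * W(S) / (|S| - 1)], whose last step counts
    the edges of [G[S]]. *)
Lemma balanced_light_edge_ratio (R : realType) (D : nat) (L : R) (V : finType)
    (e : rel V) (w : V -> V -> R) (S : {set V}) :
  (2 <= D)%N -> is_tree e -> edge_weights e w -> max_degree_le e D ->
  sup (weight_values e w) / inf (weight_values e w) <= L ->
  connected_on e S -> (2 <= #|S|)%N -> balanced_light_edge e w D L S.
Proof.
move=> D2 htree hw hdeg hL cS S2; have [wsym wpos] := hw.
have [e_sym e_irr _ _] := htree.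
have [a [b [ab balA balB]]] := balanced_edge htree hdeg cS S2.
have /and3P[aS bS eab] := ab.
have ba : induced e S b a by rewrite inducedE aS bS e_sym.
exists a, b, (side e S a b), (side e S b a); split=> //.
- exact: components_cut.
- by rewrite ge_max !side_card_le // ltnW.
have [c c0 wc] := min_edge_weight_gt0 hw.
have wval x y : e x y -> weight_values e w (w x y) by move=> exy; exists x, y.
(* Positivity of the infimum is what allows the ratio hypothesis to be cleared of its
   denominator. *)
have inf_gt0 : 0 < inf (weight_values e w).
  apply: lt_le_trans c0 _; apply: lb_le_inf.
    by exists (w a b); apply: wval.
  by move=> _ [x [y [exy ->]]]; apply: wc.
have inf_le x y : e x y -> inf (weight_values e w) <= w x y.
  move=> exy; apply: ge_inf; last exact: wval.
  by exists c => _ [u [v [euv ->]]]; apply: wc.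
have le_sup : w a b <= sup (weight_values e w).
  apply: ub_le_sup; last exact: wval.
  exists (\sum_(p : V * V | e p.1 p.2) w p.1 p.2) => _ [u [v [euv ->]]].
  exact: edge_weight_le_sum.
have S1 : 0 < #|S|%:R - 1 :> R by rewrite subr_gt0 ltr1n.
have L0 : 0 <= L.
  apply: le_trans hL; rewrite divr_ge0 ?(ltW inf_gt0) //.
  by apply: le_trans le_sup; apply/ltW/wpos.
apply: le_trans le_sup _; move: hL; rewrite ler_pdivrMr // => /le_trans; apply.
rewrite ler_wpM2l // ler_pdivlMr //.
by apply: connected_weight_ge => //; apply: ltnW.
Qed.

Theorem corollary12 (R : realType) (Delta : nat) (Lambda : R) (V : finType)
    (e : rel V) (w : V -> V -> R)
    (hDelta : (2 <= Delta)%N)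
    (hV : (2 <= #|V|)%N)
    (htree : is_tree e)
    (hw : edge_weights e w)
    (hdeg : max_degree_le e Delta) :
  ((forall S : {set V}, connected_on e S -> (2 <= #|S|)%N ->
      balanced_light_edge e w Delta Lambda S) ->
   OPT_card e w / OPT_free e w
     <= Lambda * (1 + (Num.floor (logb (Delta%:R / (Delta%:R - 1) : R)
                                       (#|V|%:R - 1)))%:~R))
  /\
  (sup (weight_values e w) / inf (weight_values e w) <= Lambda ->
   OPT_card e w / OPT_free e w
     <= Lambda * (1 + (Num.floor (logb (Delta%:R / (Delta%:R - 1) : R)
                                       (#|V|%:R - 1)))%:~R)).
Proof.
split=> [|ratio]; first exact: OPT_ratio_le.
by apply: OPT_ratio_le => // S; apply: balanced_light_edge_ratio.
Qed.
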